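(* Let $S=\{g_1,\dots,g_s\}\subset\mathbb{R}[X_0]$ be a finite set of homogeneous polynomials of even degree, and let $K_S^p$ be the corresponding projective semialgebraic set. Let $f\in\mathbb{R}[X_0]$ be a homogeneous polynomial of even degree which is positive on $K_S^p$. Then there exists $N\in\mathbb{N}$ such that $(x_0^2+\dots+x_n^2)^N f\in M_S^h$.
   Context: $\mathbb{R}[X_0]:=\mathbb{R}[x_0,x_1,\dots,x_n]$. For a homogeneous polynomial of even degree, its sign at a point of $\mathbb{R}P^n$ is well defined (as the sign at any representative). For a finite set $S=\{g_1,\dots,g_s\}$ of homogeneous polynomials of even degree, $K_S^p:=\{x\in\mathbb{R}P^n\mid g_i(x)\ge 0,\ i=1,\dots,s\}$. ''Positive'' means $>0$ at every point of the set. $\sum\mathbb{R}[X_0]^2_h$ denotes the set of finite sums of squares of homogeneous polynomials of the same degree. The homogeneous quadratic module $M_S^h$ is the set of all sums $\sum_{i=0}^{s}\sigma_i g_i$ with $g_0:=1$ and $\sigma_i\in\sum\mathbb{R}[X_0]^2_h$, such that all terms $\sigma_i g_i$ have the same degree (zero terms are allowed and are regarded as homogeneous of any degree). *)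

(* Defs.v *)
From mathcomp Require Import all_boot all_order all_algebra.
From mathcomp Require Import mpoly.
From mathcomp Require Import reals.

Set Implicit Arguments.
Unset Strict Implicit.
Unset Printing Implicit Defensive.

Import Order.TTheory GRing.Theory Num.Theory.
Local Open Scope ring_scope.

(* Points are lines through the origin of R^(n+1). *)
Record projective_space (R : realType) (n : nat) := ProjPoint {
  proj_line :> {vspace 'rV[R]_n.+1};
  proj_lineP : \dim proj_line == 1%N }.

Definition even_form (R : realType) (m : nat) (p : {mpoly R[m]}) : Prop :=
  exists2 d, ~~ odd d & p \is d.-homog.

Definition eval_at (R : realType) (n : nat) (p : {mpoly R[n.+1]})
    (v : 'rV[R]_n.+1) : R := p.@[fun i => v 0 i].

(* The representative [vpick x] is an arbitrary nonzero vector of the line [x];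
   by [proj_signE] the choice is immaterial for forms of even degree. *)
Definition proj_sign (R : realType) (n : nat) (p : {mpoly R[n.+1]})
    (x : projective_space R n) : R := Num.sg (eval_at p (vpick x)).

Definition proj_semialg (R : realType) (n s : nat)
    (g : 'I_s -> {mpoly R[n.+1]}) (x : projective_space R n) : Prop :=
  forall i, 0 <= proj_sign (g i) x.

Definition positive_on (R : realType) (n : nat) (f : {mpoly R[n.+1]})
    (K : projective_space R n -> Prop) : Prop :=
  forall x, K x -> 0 < proj_sign f x.

Definition sos_forms (R : realType) (m : nat) (p : {mpoly R[m]}) : Prop :=
  exists (e : nat) (hs : seq {mpoly R[m]}),
    {in hs, forall h, h \is e.-homog} /\ p = \sum_(h <- hs) h ^+ 2.

(* [gens g] is the family g_0, ..., g_s with g_0 = 1; index [i.+1] of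
   [gens g] is index [i] of [g]. *)
Definition gens (R : realType) (m s : nat) (g : 'I_s -> {mpoly R[m]})
    (i : 'I_s.+1) : {mpoly R[m]} := oapp g 1 (unlift ord0 i).

(* [0 \is d.-homog] holds for every [d], so zero terms are allowed. *)
Definition homog_quad_module (R : realType) (m s : nat)
    (g : 'I_s -> {mpoly R[m]}) (p : {mpoly R[m]}) : Prop :=
  exists (d : nat) (sigma : 'I_s.+1 -> {mpoly R[m]}),
    [/\ forall i, sos_forms (sigma i),
        forall i, sigma i * gens g i \is d.-homog
      & p = \sum_(i < s.+1) sigma i * gens g i].

Lemma eval_atZ (R : realType) (n d : nat) (p : {mpoly R[n.+1]}) (c : R)
    (v : 'rV[R]_n.+1) :
  p \is d.-homog -> eval_at p (c *: v) = c ^+ d * eval_at p v.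
Proof.
move=> /dhomogP hp; rewrite /eval_at !mevalE mulr_sumr.
rewrite big_seq [RHS]big_seq; apply: eq_bigr => m mp.
rewrite mulrCA; congr (_ * _).
rewrite (eq_bigr (fun i => c ^+ m i * v 0 i ^+ m i)); last first.
  by move=> i _; rewrite mxE exprMn.
by rewrite big_split /= prodrXr -mdegE (hp m mp).
Qed.

Lemma proj_signE (R : realType) (n : nat) (p : {mpoly R[n.+1]})
    (x : projective_space R n) (v : 'rV[R]_n.+1) :
  even_form p -> v \in (x : {vspace _}) -> v != 0 ->
  proj_sign p x = Num.sg (eval_at p v).
Proof.
move=> [d d_even hp] vx v0.
have xE : (x : {vspace _}) = <[v]>%VS.
  apply/esym/eqP; rewrite eqEdim -memvE vx /=.
  by rewrite (eqP (proj_lineP x)) dim_vline v0.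
have : vpick x \in <[v]>%VS by rewrite -xE memv_pick.
move=> /vlineP[c cE]; rewrite /proj_sign cE (eval_atZ _ _ hp) sgrM.
have c0 : c != 0.
  apply/eqP => c0; move: cE; rewrite c0 scale0r => /eqP; rewrite vpick0 => /eqP x0.
  by have := proj_lineP x; rewrite x0 dimv0.
by rewrite gtr0_sg ?mul1r// lt_def expf_neq0//= exprn_even_ge0.
Qed.

(* Main.v *)
Require Import Defs.
From mathcomp Require Import all_boot all_order all_algebra.
From mathcomp Require Import reals ring lra.
From mathcomp Require boolp classical_sets filter topology normedtype derive.

Set Implicit Arguments.
Unset Strict Implicit.
Unset Printing Implicit Defensive.

Import Order.TTheory GRing.Theory Num.Theory.
Local Open Scope ring_scope.

(** The idea is to trade points [x] for the squares of the linear forms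
    [x_i + x_j] and [x_i - x_j], regarded as independent nonnegative variables
    [y]: positivity on the whole orthant is governed by Polya's theorem, and a
    monomial in [y] becomes a square once the squares are put back.

    The substitution [y_(+,i,j) = (x_i + x_j)^2], [y_(-,i,j) = (x_i - x_j)^2]
    maps the sum of the variables to [4 (n+1) |x|^2], and every form of degree
    [2d] in [x] is the image of a form of degree [d] in [y], because
    [4 x_i x_j = (x_i + x_j)^2 - (x_i - x_j)^2] ([subst_surj]).  A point [y] of
    the standard simplex comes from some [x] as soon as it satisfies finitely
    many homogeneous equations, which say that the numbers [X_ij] standing for
    [x_i x_j] form a rank one matrix compatible with [y] ([square_image]).
    Adding [- r^2 >= 0] to the constraints for each such equation [r = 0] turns
    positivity of [f] on the projective set into positivity of a lift of [f] on
    the part of the simplex where all constraints hold.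

    There, Schweighofer's perturbation applies.  With the constraints scaled to
    be at most [1], the function [(1 - t)^K t] is at most [1/K] for [t <= 1] and
    at most [- K d^2] for [t <= - d]; hence by compactness of the simplex
    subtracting from [f] the sum of the [(1 - g_i)^K g_i], with [K] even and
    large, leaves something positive on the whole simplex
    ([simplex_certificate]).  Each subtracted term is a square times a
    constraint.  By Polya's theorem ([polya]) the remainder, multiplied by a
    power of the sum of the variables, has nonnegative coefficients.

    Putting the squares back, the terms of the equations vanish, the remainder
    becomes a sum of squares of products of linear forms, and the sum of the
    variables becomes a multiple of [|x|^2], itself a sum of squares of
    linear forms. *)

(** * Compactness of the simplex *)

Definition in_simplex (R : numDomainType) (m : nat) (v : 'I_m -> R) :=
  (forall i, 0 <= v i) /\ \sum_i v i = 1.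

Section Compactness.
Import boolp classical_sets filter topology normedtype derive.
Import numFieldNormedType.Exports.
Local Open Scope classical_set_scope.
Variables (R : realType) (m : nat).

Lemma continuous_sumr (T : topologicalType) (I : Type) (r : seq I)
    (F : I -> T -> R) :
  (forall i, continuous (F i)) -> continuous (fun x => \sum_(i <- r) F i x).
Proof.
move=> cF; apply: (@continuous_big R I +%R 0 predT _ T r F) => // x.
exact: (@add_continuous R x).
Qed.

Lemma continuous_monomial (T : topologicalType) (F : 'I_m -> T -> R)
    (c : R) (e : 'I_m -> nat) :
  (forall i, continuous (F i)) ->
  continuous (fun x => c * \prod_i F i x ^+ e i).
Proof.
move=> cF x; apply: cvgM; first exact: cvg_cst.
move: x; apply: (@continuous_big R _ *%R 1 predT _ T _
                   (fun i x => F i x ^+ e i)) => [x|i _].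
  exact: (@mul_continuous R x).
elim: (e i) => [|k IH] x; first exact: cvg_cst.
under eq_fun do rewrite exprS.
by apply: cvgM; [exact: cF|exact: IH].
Qed.

Lemma continuous_add_norm (T : topologicalType) (F : T -> R) :
  continuous F -> continuous (fun x => F x + `|F x|).
Proof. by move=> cF x; apply: cvgD; [|apply: cvg_norm]; exact: cF. Qed.

Lemma compact_simplex : compact [set v : 'rV[R]_m | in_simplex (v 0)].
Proof.
have cpt : compact [set v : 'rV[R]_m | forall i, `[0, 1]%classic (v ord0 i)].
  apply: (@rV_compact R m (fun=> `[0, 1]%classic)) => i.
  exact: (@segment_compact R 0 1).
pose total (v : 'rV[R]_m) := \sum_i v 0 i.
have ctotal : continuous total.
  apply: continuous_sumr => i; exact: coord_continuous.
have cl : closed (total @^-1` [set x | x = 1]).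
  by move/continuous_closedP: ctotal; apply; exact: closed_eq.
have -> : [set v : 'rV[R]_m | in_simplex (v 0)] = 
   [set v : 'rV[R]_m | forall i, `[0, 1]%classic (v ord0 i)]
       `&` total @^-1` [set x | x = 1].
  apply/seteqP; split=> v [v_ge0 v1]; split=> // i.
    rewrite /= in_itv /= v_ge0 -v1 (bigD1 i) //= lerDl.
    by apply: sumr_ge0 => j _; exact: v_ge0.
  by have /= := v_ge0 i; rewrite in_itv => /andP[].
apply: compact_closedI => //.
Qed.

Lemma min_on_simplex (F : 'rV[R]_m -> R) :
  continuous F -> (forall v : 'rV[R]_m, in_simplex (v 0) -> 0 < F v) ->
  exists2 e, 0 < e & forall v : 'rV[R]_m, in_simplex (v 0) -> e <= F v.
Proof.
move=> cF F_gt0.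
have [E0|/set0P nonempty] := eqVneq [set v : 'rV[R]_m | in_simplex (v 0)] set0.
  exists 1 => // v v_in.
  by have : [set v : 'rV[R]_m | in_simplex (v 0)] v by []; rewrite E0.
have [w w_in w_min] :=
  EVT_min_rV nonempty compact_simplex (continuous_subspaceT cF).
exists (F w); first by apply: F_gt0; have := w_in; rewrite inE.
by move=> v v_in; apply: w_min; rewrite inE.
Qed.

(** The maximum of the [F i] is positive on a compact set, so it is bounded away
    from [0]; the sum of the positive parts (here doubled, [t + `|t|]) plays the
    role of the maximum. *)
Lemma some_ge_on_simplex (I : finType) (F : I -> 'rV[R]_m -> R) :
  (forall i, continuous (F i)) ->
  (forall v : 'rV[R]_m, in_simplex (v 0) -> exists i, 0 < F i v) ->
  exists2 e, 0 < e & forall v : 'rV[R]_m, in_simplex (v 0) -> exists i, e <= F i v.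
Proof.
move=> cF F_pos.
pose H (v : 'rV[R]_m) := \sum_i (F i v + `|F i v|).
have term_ge0 (x : R) : 0 <= x + `|x|.
  by rewrite addrC -lerBlDr sub0r -normrN ler_norm.
have cH : continuous H.
  by apply: continuous_sumr => i; apply: continuous_add_norm; exact: cF.
have [v v_in|e e_gt0 He] := min_on_simplex cH.
  have [i Fi] := F_pos v v_in.
  rewrite /H (bigD1 i) //= ltr_pwDl //.
    by rewrite (gtr0_norm Fi) addr_gt0.
  by apply: sumr_ge0 => j _.
have [d d_gt0 eE] : exists2 d, 0 < d & e = 2 * d * #|I|.+1%:R.
  exists (e / (2 * #|I|.+1%:R)); first by rewrite divr_gt0 // mulr_gt0 // ltr0n.
  by field; rewrite nat1r pnatr_eq0.
exists d => // v v_in.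
case: (pickP (fun i => d <= F i v)) => [i Fi|F_small]; first by exists i.
have := He v v_in; rewrite leNgt => /negP[].
apply: (@le_lt_trans _ _ (\sum_(i : I) 2 * d)).
  apply: ler_sum => i _.
  have Fi : F i v < d by rewrite ltNge F_small.
  have [Fi0|Fi0] := lerP 0 (F i v); last first.
    by rewrite (ltr0_norm Fi0) subrr mulr_ge0 // ltW.
  by rewrite (ger0_norm Fi0) mulr_natl mulr2n lerD // ltW.
by rewrite sumr_const -[ltLHS]mulr_natr eE ltr_pM2l ?mulr_gt0 // ltr_nat.
Qed.

(** The sums are written out in the shape of the value at [v] of a multivariate
    polynomial, with [r i] its monomials. *)
Lemma monomial_sums_lower_bound (I : finType) (T : Type) (r : I -> seq T)
    (c : I -> T -> R) (e : T -> 'I_m -> nat) :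
  let F i (v : 'I_m -> R) := \sum_(a <- r i) c i a * \prod_j v j ^+ e a j in
  (forall v, in_simplex v -> exists i, 0 < F i v) ->
  exists2 d, 0 < d & forall v, in_simplex v -> exists i, d <= F i v.
Proof.
move=> F F_pos.
have cF i : continuous (fun v : 'rV[R]_m => F i (v 0)).
  apply: continuous_sumr => a; apply: continuous_monomial => j.
  exact: coord_continuous.
have [v v_in|d d_gt0 Hd] := some_ge_on_simplex cF; first exact: F_pos.
exists d => // v [v_ge0 v1].
have vE : (\row_i v i) 0 =1 v by move=> i; rewrite mxE.
have [|i Fi] := Hd (\row_i v i); last first.
  exists i; apply: le_trans Fi _; rewrite le_eqVlt; apply/orP; left; apply/eqP.
  by apply: eq_bigr => a _; congr (_ * _); apply: eq_bigr => j _; rewrite vE.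
split=> [i|]; first by rewrite vE.
by rewrite -v1; apply: eq_bigr => i _.
Qed.

End Compactness.

From mathcomp Require Import mpoly.

(** * Polynomials on the simplex *)

Section SimplexBounds.
Variables (R : realType) (m : nat).
Implicit Types (p : {mpoly R[m]}) (v : 'I_m -> R).

Lemma simplex_lower_bound (I : finType) (F : I -> {mpoly R[m]}) :
  (forall v, in_simplex v -> exists i, 0 < (F i).@[v]) ->
  exists2 e, 0 < e & forall v, in_simplex v -> exists i, e <= (F i).@[v].
Proof.
exact: (monomial_sums_lower_bound (r := fun i => msupp (F i))
          (c := fun i a => (F i)@_a) (e := fun a j => a j)).
Qed.

Lemma simplex_le1 v i : in_simplex v -> v i <= 1.
Proof.
move=> [v_ge0 <-]; rewrite (bigD1 i) //= lerDl.
by apply: sumr_ge0 => j _.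
Qed.

Lemma simplex_upper_bound p :
  exists2 M, 0 <= M & forall v, in_simplex v -> `|p.@[v]| <= M.
Proof.
exists (\sum_(a <- msupp p) `|p@_a|); first by apply: sumr_ge0.
move=> v v_in; rewrite mevalE (le_trans (ler_norm_sum _ _ _)) //.
apply: ler_sum => a _; rewrite normrM ler_piMr //.
have v_ge0 := v_in.1.
rewrite ger0_norm; last by apply: prodr_ge0 => i _; rewrite exprn_ge0.
apply: prodr_ile1 => i _; rewrite exprn_ge0 //= exprn_ile1 //.
exact: simplex_le1.
Qed.
End SimplexBounds.

(** * Polya's theorem *)

Section Polya.
Variables (R : realType) (m : nat).
Implicit Types (p : {mpoly R[m]}) (v : 'I_m -> R) (a b : 'X_{1..m}).

Definition var_sum : {mpoly R[m]} := \sum_i 'X_i.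

Lemma var_sum_homog : var_sum \is 1.-homog.
Proof. by apply: rpred_sum => i _; rewrite dhomogX /= mdeg1. Qed.

Lemma mcoeff_var_sumM p b :
  (var_sum * p)@_b = \sum_(i | b i != 0%N) p@_(b - U_(i)).
Proof.
rewrite mulr_suml raddf_sum [RHS]big_mkcond /=; apply: eq_bigr => i _.
rewrite -commr_mpolyX; have [bi0|bi0] := eqVneq (b i) 0%N; last first.
  have -> : b = (U_(i) + (b - U_(i)))%MM by rewrite addmC submK // lep1mP.
  by rewrite mcoeffMX addmC addmK.
apply: memN_msupp_eq0; rewrite (perm_mem (msuppMX _ _)).
by apply/mapP => -[c _ bE]; move: bi0; rewrite bE mnmDE mnm1E eqxx.
Qed.

(** [mfact b] is [b!] and [mffact a b] the falling factorial of [b] by [a], both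
    for multi-indices. *)
Definition mfact b : nat := \prod_i (b i)`!.
Definition mffact a b : nat := \prod_i (b i) ^_ (a i).

Lemma mffact_eq0 a b : ~~ (a <= b)%MM -> mffact a b = 0%N.
Proof.
move=> /mnm_lepP ab.
have [i] : exists i, (b i < a i)%N.
  apply/existsP; apply: contra_notT ab; rewrite negb_exists => /forallP ab i.
  by rewrite leqNgt.
by move=> bai; rewrite /mffact (bigD1 i) //= ffact_small.
Qed.

Lemma mdeg_le_eq a b : (a <= b)%MM -> mdeg a = mdeg b -> a = b.
Proof.
move=> ab dab; apply/esym; rewrite -(submK ab).
have : mdeg (b - a) = 0%N.
  by apply/eqP; rewrite -(eqn_add2r (mdeg a)) -mdegD submK // dab.
by move/eqP; rewrite mdeg_eq0 => /eqP ->; rewrite add0m.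
Qed.

(** Each summand is [(b_i - a_i)] times the falling factorial, since
    [n * (n - 1)^_a = n^_a.+1 = n^_a * (n - a)] even when the subtraction is
    truncated. *)
Lemma mffact_pred a b :
  (\sum_i b i * mffact a (b - U_(i)) = (mdeg b - mdeg a) * mffact a b)%N.
Proof.
have step i : (b i * mffact a (b - U_(i)) = (b i - a i) * mffact a b)%N.
  rewrite /mffact [in LHS](bigD1 i) //= [in RHS](bigD1 i) //= !mulnA.
  congr (_ * _)%N; last first.
    by apply: eq_bigr => j ji; rewrite mnmBE mnm1E eq_sym (negPf ji) subn0.
  by rewrite mnmBE mnm1E eqxx subn1 -ffactnS ffactnSr mulnC.
rewrite (eq_bigr _ (fun i _ => step i)) -big_distrl /=.
have [ab|/mffact_eq0 ->] := boolP (a <= b)%MM; last by rewrite !muln0.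
congr (_ * _)%N; rewrite !mdegE sumnB // => i _; exact: (mnm_lepP ab).
Qed.

(** The form [p] with powers replaced by falling factorials: up to scaling, a
    perturbation of the value of [p] at [b]. *)
Definition falling_eval p b : R := \sum_(a <- msupp p) p@_a * (mffact a b)%:R.

(** Polya's coefficient formula.  Multiplying by the sum of the variables adds
    up the coefficients at the predecessors of [b], so the induction step is
    [mffact_pred]; this avoids expanding the power by the multinomial theorem. *)
Lemma mcoeff_var_sumXM d p N b : p \is d.-homog -> mdeg b = (N + d)%N ->
  (mfact b)%:R * (var_sum ^+ N * p)@_b = N`!%:R * falling_eval p b.
Proof.
move=> hp; elim: N b => [|N IH] b db.
  rewrite expr0 !mul1r /falling_eval.
  rewrite (bigID (pred1 b)) /= [X in _ = _ + X]big1_seq ?addr0; last first.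
    move=> a /andP[anb ap]; rewrite mffact_eq0 ?mulr0 //.
    apply: contra anb => ab; apply/eqP; apply: mdeg_le_eq => //.
    by rewrite db (dhomog_mf hp ap).
  have [bp|bp] := boolP (b \in msupp p); last first.
    rewrite (memN_msupp_eq0 bp) mulr0 big1_seq // => a /andP[/eqP -> ab].
    by rewrite ab in bp.
  rewrite -big_filter filter_pred1_uniq ?msupp_uniq // big_seq1 mulrC.
  by congr (_ * _%:R); apply: eq_bigr => i _; rewrite ffactnn.
rewrite exprS -mulrA mcoeff_var_sumM mulr_sumr.
transitivity (\sum_i (b i)%:R * (N`!%:R * falling_eval p (b - U_(i)))).
  rewrite big_mkcond /=; apply: eq_bigr => i _.
  have [->|bi0] := eqVneq (b i) 0%N; first by rewrite mul0r.
  have Uib : (U_(i) <= b)%MM by rewrite lep1mP.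
  rewrite -IH; last first.
    by apply/eqP; rewrite -(eqn_add2r (mdeg U_(i)%MM)) -mdegD submK // db mdeg1 addn1.
  rewrite mulrA; congr (_ * _); rewrite -natrM; congr (_%:R).
  rewrite /mfact (bigD1 i) //= [in RHS](bigD1 i) //= mulnA mnmBE mnm1E eqxx subn1.
  congr (_ * _)%N; last first.
    by apply: eq_bigr => j ji; rewrite mnmBE mnm1E eq_sym (negPf ji) subn0.
  by case: (b i) bi0 => // k _; rewrite factS.
under eq_bigr do rewrite mulrCA.
rewrite -mulr_sumr factS natrM [_.+1%:R * _]mulrC -mulrA; congr (_ * _).
under eq_bigr do rewrite /falling_eval mulr_sumr.
rewrite exchange_big /= /falling_eval mulr_sumr !big_seq.
apply: eq_bigr => a ap.
under eq_bigr do rewrite mulrCA -natrM.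
rewrite -mulr_sumr -natr_sum mffact_pred db (dhomog_mf hp ap) /= addnK.
by rewrite natrM mulrCA.
Qed.

Lemma prod_norm_le1 (I : Type) (r : seq I) (x : I -> R) :
  (forall i, `|x i| <= 1) -> `|\prod_(i <- r) x i| <= 1.
Proof.
by move=> x1; rewrite normr_prod; apply: prodr_ile1 => i _; rewrite normr_ge0 x1.
Qed.

(** Telescoping, with all remaining factors in the unit ball. *)
Lemma prod_dist (I : Type) (r : seq I) (x y : I -> R) :
  (forall i, `|x i| <= 1) -> (forall i, `|y i| <= 1) ->
  `|\prod_(i <- r) x i - \prod_(i <- r) y i| <= \sum_(i <- r) `|x i - y i|.
Proof.
move=> x1 y1; elim: r => [|i r IH]; first by rewrite !big_nil subrr normr0.
rewrite !big_cons.
set X := \prod_(j <- r) x j in IH *; set Y := \prod_(j <- r) y j in IH *.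
have -> : x i * X - y i * Y = (x i - y i) * X + y i * (X - Y) by ring.
rewrite (le_trans (ler_normD _ _)) // !normrM lerD //.
  by rewrite ler_piMr // prod_norm_le1.
by rewrite (le_trans _ IH) // ler_piMl.
Qed.

(** After scaling by [1 / |b|] the falling factorial differs from the power by
    [O(1 / |b|)]: each of the [|a|] factors moves by at most [|a| / |b|]. *)
Lemma mffact_dist a b : (0 < mdeg b)%N ->
  `|(mffact a b)%:R / (mdeg b)%:R ^+ mdeg a
    - \prod_i ((b i)%:R / (mdeg b)%:R) ^+ a i|
    <= (mdeg a)%:R ^+ 2 / (mdeg b)%:R :> R.
Proof.
move=> b_gt0; set k : R := (mdeg b)%:R; have k_gt0 : 0 < k by rewrite ltr0n.
have ratio_le1 i j : `|(b i - j)%:R / k| <= 1.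
  rewrite ger0_norm; last by rewrite divr_ge0 // ltW.
  rewrite ler_pdivrMr // mul1r ler_nat.
  by rewrite (leq_trans (leq_subr _ _)) // mdegE (bigD1 i) //= leq_addr.
have ratio0_le1 i : `|(b i)%:R / k| <= 1 by have := ratio_le1 i 0; rewrite subn0.
have -> : (mffact a b)%:R / k ^+ mdeg a
          = \prod_i \prod_(j < a i) ((b i - j)%:R / k).
  rewrite mdegE -prodrXr natr_prod -prodf_div; apply: eq_bigr => i _.
  by rewrite ffact_prod natr_prod prodf_div prodr_const card_ord.
have -> : \prod_i ((b i)%:R / k) ^+ a i
          = \prod_i \prod_(j < a i) ((b i)%:R / k).
  by apply: eq_bigr => i _; rewrite prodr_const card_ord.
apply: le_trans (prod_dist _ _ _) _ => [i|i|].
- exact: prod_norm_le1.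
- exact: prod_norm_le1.
rewrite expr2 -mulrA mulrC {2}mdegE natr_sum mulr_sumr.
apply: ler_sum => i _.
apply: le_trans (prod_dist _ _ _) _ => [j|j|] //.
apply: (@le_trans _ _ (\sum_(j < a i) ((mdeg a)%:R / k))); last first.
  by rewrite sumr_const card_ord -[leLHS]mulr_natr.
apply: ler_sum => j _; rewrite -mulrBl normrM (gtr0_norm (x := k^-1)) ?invr_gt0 //.
rewrite ler_pM2r ?invr_gt0 // distrC ger0_norm ?subr_ge0 ?ler_nat ?leq_subr //.
have ja : (j <= mdeg a)%N.
  by rewrite (leq_trans (ltnW (ltn_ord j))) // mdegE (bigD1 i) //= leq_addr.
have [jb|bj] := leqP j (b i).
  by rewrite natrB // opprB addrC subrK ler_nat.
have -> : (b i - j = 0)%N by apply/eqP; rewrite subn_eq0 ltnW.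
by rewrite subr0 ler_nat (leq_trans (ltnW bj)).
Qed.

(** At a multi-index [b] of degree [N + d], the coefficient of [var_sum ^+ N * p]
    has the sign of [falling_eval p b], which divided by [|b|^d] is within
    [O(1 / |b|)] of the value of [p] at the point [b / |b|] of the simplex,
    where [p] is at least [e]. *)
Theorem polya d p e : p \is d.-homog -> 0 < e ->
  (forall v, in_simplex v -> e <= p.@[v]) ->
  exists N, forall b, 0 <= (var_sum ^+ N * p)@_b.
Proof.
move=> hp e_gt0 p_ge.
pose A := \sum_(a <- msupp p) `|p@_a|.
have A_ge0 : 0 <= A by apply: sumr_ge0.
pose C := A * d%:R ^+ 2 / e.
have C_ge0 : 0 <= C by rewrite divr_ge0 ?mulr_ge0 ?sqr_ge0 // ltW.
pose N := (Num.bound C).+1; exists N => b.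
have hN : var_sum ^+ N * p \is (N + d).-homog.
  by rewrite -{2}[N]mul1n dhomogM ?dhomogMn ?var_sum_homog.
have [db|db] := eqVneq (mdeg b) (N + d)%N; last first.
  by rewrite (dhomog_nemf_coeff hN db).
have b_gt0 : (0 < mdeg b)%N by rewrite db addSn.
have mfact_gt0 : 0 < (mfact b)%:R :> R.
  by rewrite ltr0n prodn_gt0 // => i; exact: fact_gt0.
rewrite -(pmulr_rge0 _ mfact_gt0) (mcoeff_var_sumXM hp db) mulr_ge0 //.
pose k : R := (mdeg b)%:R; have k_gt0 : 0 < k by rewrite ltr0n.
pose v i := (b i)%:R / k.
have v_in : in_simplex v.
  split=> [i|]; first by rewrite divr_ge0 // ltW.
  by rewrite -mulr_suml -natr_sum -mdegE divff // gt_eqF.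
rewrite -(pmulr_lge0 _ (_ : 0 < (k ^+ d)^-1)) ?invr_gt0 ?exprn_gt0 //.
have dist : `|falling_eval p b / k ^+ d - p.@[v]| <= A * (d%:R ^+ 2 / k).
  rewrite mevalE /falling_eval mulr_suml -sumrB mulr_suml.
  rewrite (le_trans (ler_norm_sum _ _ _)) // !big_seq; apply: ler_sum => a ap.
  rewrite -mulrA -mulrBr normrM ler_wpM2l //.
  by have := mffact_dist a b_gt0; rewrite (dhomog_mf hp ap).
have small : A * (d%:R ^+ 2 / k) <= e.
  rewrite mulrA ler_pdivrMr // -ler_pdivrMl // mulrC -/C.
  rewrite (le_trans (ltW (archi_boundP C_ge0))) // ler_nat db.
  by rewrite (leq_trans (leqnSn _)) // leq_addr.
have := le_trans dist small; rewrite ler_norml => /andP[lo _].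
by have := p_ge v v_in; lra.
Qed.

End Polya.

(** * Removing constraints by a bounded perturbation *)

Section Perturbation.
Variable R : realType.
Implicit Types (x t y : R).

Lemma bernoulli x n : 0 <= x -> 1 + n%:R * x <= (1 + x) ^+ n.
Proof.
move=> x_ge0; elim: n => [|n IH]; first by rewrite mul0r addr0 expr0.
rewrite exprS; apply: le_trans (ler_wpM2l _ IH); last by rewrite addr_ge0.
rewrite -natr1.
have : 0 <= n%:R * x * x by rewrite !mulr_ge0.
lra.
Qed.

(** For [0 <= t], Bernoulli's inequality gives
    [n t (1 - t)^n <= (1 + t)^n (1 - t)^n <= 1]. *)
Lemma bump_le_inv t n : (0 < n)%N -> t <= 1 -> (1 - t) ^+ n * t <= n%:R^-1.
Proof.
move=> n_gt0 t1; have n0 : 0 < n%:R :> R by rewrite ltr0n.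
have pow_ge0 : 0 <= (1 - t) ^+ n by rewrite exprn_ge0 // subr_ge0.
have [t_ge0|t_lt0] := lerP 0 t; last first.
  apply: (@le_trans _ _ 0); last by rewrite invr_ge0 ltW.
  by rewrite mulr_ge0_le0 // ltW.
rewrite -[leRHS]mul1r ler_pdivlMr // -mulrA (mulrC t).
apply: (@le_trans _ _ ((1 - t) ^+ n * (1 + t) ^+ n)).
  by rewrite ler_wpM2l // (le_trans _ (bernoulli n t_ge0)) // lerDr.
rewrite -exprMn exprn_ile1 //; nra.
Qed.

Lemma bump_le_neg t d n : 0 < d -> t <= - d ->
  (1 - t) ^+ n * t <= - (n%:R * d ^+ 2).
Proof.
move=> d_gt0 td.
have t_ge0 : 0 <= - t by lra.
have := bernoulli n t_ge0.
have n_ge0 : 0 <= n%:R :> R by [].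
have : n%:R * d <= n%:R * - t by rewrite ler_wpM2l //; lra.
set P := (1 - t) ^+ n; set k := n%:R => *.
have P_ge : k * d <= P by lra.
have P_ge0 : 0 <= P by rewrite (le_trans _ P_ge) // mulr_ge0 // ltW.
have : P * t <= P * - d by rewrite ler_wpM2l.
have : k * d * d <= P * d by rewrite ler_wpM2r // ltW.
rewrite expr2; lra.
Qed.

(** Every bump is at most [1 / (2 k)], so in total they subtract at most [d / 2].
    That suffices where [y] is at least [d]; where some [t i] is at most [- d],
    subtracting its bump adds at least [M + d].  The exponent is even so that
    the factors [(1 - t i) ^+ (k * 2)] are squares. *)
Lemma bump_perturbation (I : finType) (M d : R) : 0 < d ->
  exists k, forall (t : I -> R) y, - M <= y -> (forall i, t i <= 1) ->
    (d <= y \/ exists i, t i <= - d) ->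
    d / 2 <= y - \sum_i (1 - t i) ^+ (k * 2) * t i.
Proof.
move=> d_gt0.
pose C := `|2 * #|I|%:R / d| + `|(M + d) / d ^+ 2|.
have C_ge0 : 0 <= C by rewrite addr_ge0.
pose k := (Num.bound C).+1; pose n := (k * 2)%N.
have n_gt0 : (0 < n)%N by rewrite muln_gt0.
have n0 : 0 < n%:R :> R by rewrite ltr0n.
have C_le : C <= n%:R.
  rewrite (le_trans (ltW (archi_boundP C_ge0))) // ler_nat.
  by rewrite (leq_trans (leqnSn _)) // leq_pmulr.
have nI : #|I|%:R * n%:R^-1 <= d / 2.
  have : 2 * #|I|%:R / d <= n%:R.
    by rewrite (le_trans _ C_le) // (le_trans (ler_norm _)) // lerDl.
  rewrite !ler_pdivrMr //; lra.
have nM : M + d <= n%:R * d ^+ 2.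
  rewrite -ler_pdivrMr ?exprn_gt0 //.
  by rewrite (le_trans _ C_le) // (le_trans (ler_norm _)) // lerDr.
exists k => t y y_ge t1 [yd|[i ti]].
  have : \sum_i (1 - t i) ^+ n * t i <= #|I|%:R * n%:R^-1.
    rewrite [leRHS]mulr_natl -sumr_const; apply: ler_sum => i _.
    exact: bump_le_inv.
  rewrite -/n; lra.
have : \sum_i (1 - t i) ^+ n * t i <= #|I|%:R * n%:R^-1 - n%:R * d ^+ 2.
  rewrite (bigD1 i) //= addrC lerD ?bump_le_neg //.
  apply: (@le_trans _ _ (\sum_(j | j != i) n%:R^-1)).
    by apply: ler_sum => j _; exact: bump_le_inv.
  rewrite mulr_natl -sumr_const [leRHS](bigD1 i) //= lerDr.
  by rewrite invr_ge0 ltW.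
rewrite -/n; lra.
Qed.

End Perturbation.

(** * Certificates on the simplex *)

Section Certificate.
Variables (R : realType) (m : nat).
Let s : {mpoly R[m]} := var_sum R m.

Lemma meval_var_sum (v : 'I_m -> R) : in_simplex v -> s.@[v] = 1.
Proof.
move=> [_ <-]; rewrite raddf_sum; apply: eq_bigr => i _ /=; exact: mevalXU.
Qed.

(** Homogeneous form of the perturbation: [1] is replaced by a power of the sum
    of the variables, and all terms are brought to a common degree by further
    such powers; the remainder is then handled by Polya's theorem. *)
Theorem simplex_certificate (I : finType) (g : I -> {mpoly R[m]})
    (dg : I -> nat) (f : {mpoly R[m]}) (d : nat) :
  (forall i, g i \is (dg i).-homog) -> f \is d.-homog ->
  (forall v, in_simplex v -> (forall i, 0 <= (g i).@[v]) -> 0 < f.@[v]) ->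
  exists (N D : nat) (b e : I -> nat) (u : I -> {mpoly R[m]}),
    [/\ forall i, u i \is (e i).-homog,
        forall i, (b i + e i * 2 + dg i)%N = D,
        (N + d)%N = D &
        forall a, 0 <= (s ^+ N * f - \sum_i s ^+ b i * u i ^+ 2 * g i)@_a].
Proof.
move=> hg hf f_pos.
have [B B_gt0 g_le] :
    exists2 B, 0 < B & forall i v, in_simplex v -> (g i).@[v] <= B.
  have /fin_all_exists2[M M_ge0 Mg] i := simplex_upper_bound (g i).
  exists (1 + \sum_i M i) => [|i v v_in].
    by rewrite ltr_pwDl // sumr_ge0.
  rewrite (le_trans (ler_norm _)) // (le_trans (Mg i v v_in)) //.
  by rewrite (bigD1 i) //= addrCA lerDl addr_ge0 // sumr_ge0.
have [M M_ge0 f_le] := simplex_upper_bound f.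
pose l := B^-1; have l_gt0 : 0 < l by rewrite invr_gt0.
(* At each point of the simplex [f] is positive or some constraint is
   negative; compactness makes this uniform. *)
pose F i : {mpoly R[m]} := if i is Some j then - (l *: g j) else f.
have [v v_in|c c_gt0 Fc] := @simplex_lower_bound _ _ _ F.
  case: (pickP (fun j => (g j).@[v] < 0)) => [j gj|g_ge0].
    by exists (Some j); rewrite /= mevalN mevalZ oppr_gt0 pmulr_rlt0.
  by exists None; apply: f_pos => // j; rewrite leNgt g_ge0.
have [k Hk] := bump_perturbation I M c_gt0.
(* Any common degree at least [d] and all [dg i * (k * 2).+1] would do. *)
pose D0 := (d + \sum_i (dg i * (k * 2).+1))%N.
pose e i := (dg i * k)%N.
pose b i := (D0 - dg i * (k * 2).+1)%N.
pose u i : {mpoly R[m]} := Num.sqrt l *: (s ^+ dg i - l *: g i) ^+ k.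
have hs j : s ^+ j \is j.-homog.
  by rewrite -{2}[j]mul1n dhomogMn // var_sum_homog.
have hu i : u i \is (e i).-homog.
  by rewrite dhomogZ // dhomogMn // rpredB // dhomogZ.
have bE i : (b i + e i * 2 + dg i)%N = D0.
  have : (dg i * (k * 2).+1 <= D0)%N.
    by rewrite /D0 (bigD1 i) //= addnCA leq_addr.
  by rewrite /b /e => le; rewrite -addnA -mulnA -mulnSr subnK.
pose P := s ^+ (D0 - d) * f - \sum_i s ^+ b i * u i ^+ 2 * g i.
have hP : P \is D0.-homog.
  rewrite rpredB //.
    have {2}-> : D0 = (D0 - d + d)%N by rewrite subnK // leq_addr.
    by rewrite dhomogM.
  apply: rpred_sum => i _; rewrite -{1}(bE i).
  by rewrite !dhomogM // dhomogMn.
have P_ge v : in_simplex v -> c / 2 <= P.@[v].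
  move=> v_in; have s1 := meval_var_sum v_in.
  have -> : P.@[v] = f.@[v] - \sum_i (1 - l * (g i).@[v]) ^+ (k * 2) * (l * (g i).@[v]).
    rewrite mevalB mevalM rmorphXn /= s1 expr1n mul1r; congr (_ - _).
    rewrite raddf_sum; apply: eq_bigr => i _ /=.
    rewrite !mevalM mevalZ !rmorphXn /= mevalB mevalZ rmorphXn /= s1.
    rewrite !expr1n mul1r mulrACA -expr2 sqr_sqrtr ?ltW // muln2 -addnn exprD.
    by ring.
  apply: Hk => [|i|].
  - by have := f_le v v_in; rewrite ler_norml => /andP[].
  - by rewrite mulrC ler_pdivrMr // mul1r g_le.
  have [[j|] /= Fj] := Fc v v_in; last by left.
  by right; exists j; move: Fj; rewrite mevalN mevalZ lerNr.
have c2 : 0 < c / 2 by lra.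
have [N HN] := polya hP c2 P_ge.
exists (N + (D0 - d))%N, (N + D0)%N, (fun i => N + b i)%N, e, u.
split=> // [i||a].
- by rewrite -!addnA; congr (_ + _)%N; rewrite addnA.
- by rewrite -addnA subnK // leq_addr.
rewrite (_ : _ - _ = s ^+ N * P) // mulrBr mulrA -exprD mulr_sumr.
by congr (_ - _); apply: eq_bigr => i _; rewrite exprD -!mulrA.
Qed.

End Certificate.

(** * Sums of squares of forms of a given degree *)

Section SumsOfSquares.
Variables (R : realType) (m : nat).
Implicit Types (p q h : {mpoly R[m]}) (d e : nat).

(** The degree is kept as a parameter because sums only stay within one degree. *)
Definition sos_of_degree e p : Prop :=
  exists hs : seq {mpoly R[m]},
    {in hs, forall h, h \is e.-homog} /\ p = \sum_(h <- hs) h ^+ 2.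

Lemma sos0 e : sos_of_degree e 0.
Proof. by exists [::]; rewrite big_nil. Qed.

Lemma sos_sqr e h : h \is e.-homog -> sos_of_degree e (h ^+ 2).
Proof.
move=> hh; exists [:: h]; rewrite big_seq1; split=> // k.
by rewrite inE => /eqP ->.
Qed.

Lemma sosD e p q : sos_of_degree e p -> sos_of_degree e q ->
  sos_of_degree e (p + q).
Proof.
move=> [hs [hhs ->]] [ks [hks ->]]; exists (hs ++ ks); rewrite big_cat.
by split=> // h; rewrite mem_cat => /orP[/hhs|/hks].
Qed.

Lemma sosM d e p q : sos_of_degree d p -> sos_of_degree e q ->
  sos_of_degree (d + e) (p * q).
Proof.
move=> [hs [hhs ->]] [ks [hks ->]]; exists [seq h * k | h <- hs, k <- ks]; split.
  by move=> _ /allpairsP[[h k] [/hhs hh /hks hk ->]]; exact: dhomogM.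
rewrite big_allpairs_dep mulr_suml; apply: eq_bigr => h _.
by rewrite mulr_sumr; apply: eq_bigr => k _; rewrite exprMn.
Qed.

Lemma sosZ e (c : R) p : 0 <= c -> sos_of_degree e p -> sos_of_degree e (c *: p).
Proof.
move=> c_ge0 [hs [hhs ->]]; exists [seq Num.sqrt c *: h | h <- hs]; split.
  by move=> _ /mapP[h /hhs hh ->]; rewrite dhomogZ.
rewrite big_map scaler_sumr; apply: eq_bigr => h _.
by rewrite exprZn sqr_sqrtr.
Qed.

Lemma sosX e p n : sos_of_degree e p -> sos_of_degree (e * n) (p ^+ n).
Proof.
move=> hp; elim: n => [|n IH]; last by rewrite exprS mulnS; exact: sosM.
by rewrite muln0 expr0 -[1](expr1n _ 2); apply/sos_sqr/dhomog1.
Qed.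

Definition sqnorm : {mpoly R[m]} := \sum_i 'X_i ^+ 2.

Lemma sos_sqnorm : sos_of_degree 1 sqnorm.
Proof.
apply: big_ind; [exact: sos0|exact: sosD|move=> i _].
by apply: sos_sqr; rewrite dhomogX /= mdeg1.
Qed.

Lemma sqnorm_homog : sqnorm \is 2.-homog.
Proof.
apply: rpred_sum => i _; apply: (dhomogMn (d := 1) 2).
by rewrite dhomogX /= mdeg1.
Qed.

End SumsOfSquares.

(** * Substituting squares of linear forms *)

Section SquareSubstitution.
Variables (R : realType) (n : nat).

Definition form_index := (bool * 'I_n * 'I_n)%type.
Let m := #|{: form_index}|.

(** Diagonal pairs are kept, so that [x_i ^ 2] needs no special treatment; the
    form of [(true, i, i)] is then zero. *)
Definition pair_form (t : form_index) : {mpoly R[n]} :=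
  let: (b, i, j) := t in 'X_i + (-1) ^+ b * 'X_j.

Definition sq_forms : m.-tuple {mpoly R[n]} :=
  [tuple pair_form (enum_val i) ^+ 2 | i < m].

Notation subst p := (p \mPo sq_forms).

Definition var_at (t : form_index) : {mpoly R[m]} := 'X_(enum_rank t).

Lemma pair_form_homog t : pair_form t \is 1.-homog.
Proof.
case: t => [[b i] j] /=; rewrite rpredD // ?dhomogX /= ?mdeg1 //.
have -> : (-1) ^+ b * 'X_j = (-1) ^+ b *: 'X_j :> {mpoly R[n]}.
  by rewrite -mul_mpolyC rmorphXn rmorphN1.
by rewrite dhomogZ // dhomogX /= mdeg1.
Qed.

Lemma subst_var_at t : subst (var_at t) = pair_form t ^+ 2.
Proof. by rewrite comp_mpolyXU -tnth_nth tnth_mktuple enum_rankK. Qed.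

Lemma subst_monomial (a : 'X_{1..m}) :
  subst 'X_[a] = (\prod_(i < m) pair_form (enum_val i) ^+ a i) ^+ 2.
Proof.
rewrite comp_mpolyX -prodrXl; apply: eq_bigr => i _.
by rewrite tnth_mktuple exprAC.
Qed.

Lemma monomial_root_homog (a : 'X_{1..m}) :
  \prod_(i < m) pair_form (enum_val i) ^+ a i \is (mdeg a).-homog.
Proof.
rewrite mdegE; elim/big_ind2: _ => [|x1 x2 y1 y2 h1 h2|i _].
- exact: dhomog1.
- exact: dhomogM.
- by rewrite -{2}[a i]mul1n dhomogMn // pair_form_homog.
Qed.

Lemma subst_homog d p : p \is d.-homog -> subst p \is (d * 2).-homog.
Proof.
move=> hp; rewrite [p]mpolyE raddf_sum big_seq rpred_sum // => a ap /=.
rewrite comp_mpolyZ dhomogZ // subst_monomial.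
by rewrite dhomogMn // -(dhomog_mf hp ap) monomial_root_homog.
Qed.

(** A monomial in the new variables becomes the square of a product of linear
    forms. *)
Lemma subst_sos d p : p \is d.-homog -> (forall a, 0 <= p@_a) ->
  sos_of_degree d (subst p).
Proof.
move=> hp p_ge0; rewrite [p]mpolyE raddf_sum big_seq.
apply: big_ind => [||a ap] /=; [exact: sos0|exact: sosD|].
rewrite comp_mpolyZ subst_monomial; apply: sosZ => //; apply: sos_sqr.
by rewrite -(dhomog_mf hp ap) monomial_root_homog.
Qed.

Lemma subst_var_sum : subst (var_sum R m) = (4 * n)%:R *: sqnorm R n.
Proof.
rewrite raddf_sum /=.
rewrite (reindex (@enum_rank form_index)) /=; last first.
  by apply: onW_bij; exact: enum_rank_bij.
under eq_bigr do rewrite -/(var_at _) subst_var_at.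
transitivity (\sum_(t : form_index) pair_form (t.1.1, t.1.2, t.2) ^+ 2).
  by apply: eq_bigr => -[[b i] j].
rewrite -(pair_bigA _ (fun t j => pair_form (t.1, t.2, j) ^+ 2)) /=.
rewrite -(pair_bigA _ (fun b i => \sum_j pair_form (b, i, j) ^+ 2)) /=.
rewrite big_bool /= -big_split /=.
transitivity (\sum_i \sum_j (2 * 'X_i ^+ 2 + 2 * 'X_j ^+ 2) : {mpoly R[n]}).
  apply: eq_bigr => i _; rewrite -big_split /=; apply: eq_bigr => j _.
  by rewrite expr1 expr0; ring.
transitivity (\sum_i (2 * 'X_i ^+ 2 *+ n + 2 * sqnorm R n)).
  apply: eq_bigr => i _; rewrite big_split /= sumr_const card_ord.
  by rewrite -mulr_sumr.
rewrite big_split /= sumr_const card_ord sumrMnl -mulr_sumr -/(sqnorm R n).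
by rewrite scaler_nat mulrnA -mulrnDl; congr (_ *+ _); ring.
Qed.

(** The linear form in the new variables that stands for [x_i x_j]. *)
Definition prod_form (i j : 'I_n) : {mpoly R[m]} :=
  4^-1 *: (var_at (false, i, j) - var_at (true, i, j)).

Lemma var_at_homog t : var_at t \is 1.-homog.
Proof. by rewrite dhomogX /= mdeg1. Qed.

Lemma prod_form_homog i j : prod_form i j \is 1.-homog.
Proof. by rewrite dhomogZ // rpredB // var_at_homog. Qed.

Lemma subst_prod_form i j : subst (prod_form i j) = 'X_i * 'X_j.
Proof.
rewrite comp_mpolyZ comp_mpolyB !subst_var_at /= expr1 expr0.
have -> : ('X_i + 1 * 'X_j) ^+ 2 - ('X_i + -1 * 'X_j) ^+ 2
   = (4 : R) *: ('X_i * 'X_j) :> {mpoly R[n]} by rewrite scaler_nat; ring.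
by rewrite scalerA mulVf ?scale1r // pnatr_eq0.
Qed.

Lemma mdeg_gt0_split (a : 'X_{1..n}) d : mdeg a = d.+1 ->
  exists i a', a = (U_(i) + a')%MM /\ mdeg a' = d.
Proof.
move=> da; have [i ai] : exists i, a i != 0%N.
  apply/existsP; apply: contra_eqT da; rewrite negb_exists => /forallP a0.
  by rewrite mdegE big1 // => i _; apply/eqP; rewrite -[_ == _]negbK a0.
have aE : a = (U_(i) + (a - U_(i)))%MM by rewrite addmC submK // lep1mP.
exists i, (a - U_(i))%MM; split=> //.
by move: da; rewrite {1}aE mdegD mdeg1 add1n => -[].
Qed.

(** A monomial of degree [2d] is a product of [d] products [x_i x_j], each lifted
    by [prod_form]. *)
Lemma subst_surj d p : p \is (d * 2).-homog ->
  exists2 P, P \is d.-homog & subst P = p.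
Proof.
move=> hp; rewrite [p]mpolyE big_seq.
elim/big_ind: _ => [|_ _ [P hP <-] [Q hQ <-]|a ap].
- by exists 0; rewrite ?raddf0 // rpred0.
- by exists (P + Q); rewrite ?raddfD // rpredD.
have [P hP <-] : exists2 P, P \is d.-homog & subst P = 'X_[a].
  have := dhomog_mf hp ap; elim: d a {hp ap} => [|d IH] a.
    move=> /eqP; rewrite mdeg_eq0 => /eqP ->; exists 1; first exact: dhomog1.
    by rewrite comp_mpoly1 mpolyX0.
  move=> /mdeg_gt0_split[i [a1 [-> /mdeg_gt0_split[j [a2 [-> /IH[P hP PE]]]]]]].
  exists (prod_form i j * P); first exact: dhomogM (prod_form_homog i j) hP.
  by rewrite rmorphM /= subst_prod_form PE !mpolyXD mulrA.
by exists (p@_a *: P); rewrite ?comp_mpolyZ // dhomogZ.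
Qed.

(** Relations between the squares of the linear forms that characterize, among
    the points of the orthant, those that come from a vector [x]: [lin_rel]
    says that [y] is determined by the [X_ij], and [quad_rel] that the
    matrix [X] has rank at most one. *)
Definition lin_rel (t : form_index) : {mpoly R[m]} :=
  let: (b, i, j) := t in
  var_at t - (prod_form i i + prod_form j j + (2 * (-1) ^+ b) *: prod_form i j).

Definition quad_rel (t : 'I_n * 'I_n * 'I_n) : {mpoly R[m]} :=
  let: (i, j, k) := t in
  prod_form i j * prod_form i k - prod_form i i * prod_form j k.

Lemma lin_rel_homog t : lin_rel t \is 1.-homog.
Proof.
case: t => [[b i] j]; apply: rpredB; first exact: var_at_homog.
apply: rpredD; last exact/dhomogZ/prod_form_homog.
by apply: rpredD; exact: prod_form_homog.
Qed.

Lemma quad_rel_homog t : quad_rel t \is 2.-homog.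
Proof.
case: t => [[i j] k].
by apply: rpredB; exact: dhomogM (prod_form_homog _ _) (prod_form_homog _ _).
Qed.

Lemma subst_lin_rel t : subst (lin_rel t) = 0.
Proof.
case: t => [[b i] j].
rewrite comp_mpolyB 2!comp_mpolyD (comp_mpolyZ (2 * _)).
rewrite subst_var_at !subst_prod_form /=.
by case: b; rewrite ?expr1 ?expr0 ?mulrN1 ?mulr1 ?scaleNr scaler_nat; ring.
Qed.

Lemma subst_quad_rel t : subst (quad_rel t) = 0.
Proof.
by case: t => [[i j] k]; rewrite comp_mpolyB !rmorphM /= !subst_prod_form; ring.
Qed.

(** If [X_ii > 0], the vector [x_j = X_ij / sqrt X_ii] is a preimage by the
    rank one relations.  Such an [i] exists: if the diagonal of [X] vanished, so
    would [y], whose entries are nonnegative and satisfy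
    [y_(+,i,j) + y_(-,i,j) = 2 X_ii + 2 X_jj]. *)
Lemma square_image (y : 'I_m -> R) : in_simplex y ->
  (forall t, (lin_rel t).@[y] = 0) -> (forall t, (quad_rel t).@[y] = 0) ->
  exists x : 'rV[R]_n, x != 0 /\
    (fun i => (tnth sq_forms i).@[fun j => x 0 j]) =1 y.
Proof.
move=> [y_ge0 y1] lin0 quad0.
pose Y t := y (enum_rank t); pose X i j := (prod_form i j).@[y].
have YE b i j : Y (b, i, j) = X i i + X j j + 2 * (-1) ^+ b * X i j.
  have := lin0 (b, i, j).
  by rewrite mevalB 2!mevalD (mevalZ _ (2 * _)) mevalXU => /eqP; rewrite subr_eq0 => /eqP.
have XX i j k : X i j * X i k = X i i * X j k.
  by have := quad0 (i, j, k); rewrite mevalB !mevalM => /eqP; rewrite subr_eq0 => /eqP.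
have Y_ge0 t : 0 <= Y t by exact: y_ge0.
have Xd_ge0 i : 0 <= X i i.
  have := Y_ge0 (false, i, i); rewrite YE expr0; lra.
case: (pickP (fun i => 0 < X i i)) => [i Xi|X_le0]; last first.
  have X0 i : X i i = 0.
    by apply/eqP; rewrite eq_le Xd_ge0 andbT leNgt X_le0.
  have Y0 t : Y t = 0.
    case: t => [[b i] j]; have := Y_ge0 (false, i, j); have := Y_ge0 (true, i, j).
    by rewrite !YE !X0 expr0 expr1; case: b; rewrite ?expr0 ?expr1; lra.
  have := y1; rewrite big1 => [/eqP|i _]; first by rewrite eq_sym oner_eq0.
  by rewrite -[i]enum_valK; exact: Y0.
pose r := Num.sqrt (X i i).
have r_gt0 : 0 < r by rewrite sqrtr_gt0.
have rr : r * r = X i i by rewrite -expr2 sqr_sqrtr.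
pose x : 'rV[R]_n := \row_j (X i j / r).
have xx j k : x 0 j * x 0 k = X j k.
  rewrite !mxE mulrACA XX -invfM rr mulrAC mulfV ?mul1r //; exact: lt0r_neq0.
exists x; split=> [|a].
  apply/eqP => x0; have := xx i i; rewrite x0 !mxE mul0r => X0.
  by rewrite -X0 ltxx in Xi.
rewrite tnth_mktuple -[in RHS](enum_valK a) -/(Y _).
case: (enum_val a) => [[b j] k]; rewrite YE -!xx rmorphXn /= mevalD mevalM.
rewrite rmorphXn /= !mevalXU mevalN meval1.
by case: b; rewrite ?expr1 ?expr0; ring.
Qed.

Lemma meval_subst p (x y : _ -> R) :
  (fun i => (tnth sq_forms i).@[x]) =1 y -> (subst p).@[x] = p.@[y].
Proof. by move=> xy; rewrite comp_mpoly_meval; exact: meval_eq. Qed.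

End SquareSubstitution.

(** * Forms on projective space *)

Section EvenForms.
Variables (R : realType) (n s : nat).
Implicit Types (g : 'I_s -> {mpoly R[n.+1]}) (f : {mpoly R[n.+1]}).

Lemma positive_on_vectors g f :
  (forall i, even_form (g i)) -> even_form f ->
  positive_on f (proj_semialg g) ->
  forall x : 'rV[R]_n.+1, x != 0 ->
    (forall i, 0 <= eval_at (g i) x) -> 0 < eval_at f x.
Proof.
move=> hg hf f_pos x x0 gx.
have lineP : \dim <[x]>%VS == 1%N by rewrite dim_vline x0.
pose l := ProjPoint lineP.
have signE p : even_form p -> proj_sign p l = Num.sg (eval_at p x).
  by move=> hp; apply: proj_signE => //; exact: memv_line.
rewrite -sgr_gt0 -signE //; apply: f_pos => i.
by rewrite signE // sgr_ge0.
Qed.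

Lemma even_form_half (p : {mpoly R[n.+1]}) :
  even_form p -> exists d, p \is (d * 2).-homog.
Proof. by case=> d d_even hp; exists d./2; rewrite muln2 even_halfK. Qed.

Lemma homog_quad_module_intro g (D : nat) (f s0 : {mpoly R[n.+1]})
    (t : 'I_s -> {mpoly R[n.+1]}) :
  sos_forms s0 -> s0 \is D.-homog ->
  (forall i, sos_forms (t i)) -> (forall i, t i * g i \is D.-homog) ->
  f = s0 + \sum_i t i * g i -> homog_quad_module g f.
Proof.
move=> s0_sos hs0 t_sos ht ->.
exists D, (fun i => if unlift ord0 i is Some j then t j else s0); split.
- by move=> i; case: unliftP.
- by move=> i; rewrite /gens; case: unliftP => [j _|_] //=; rewrite mulr1.
rewrite big_ord_recl /gens unlift_none /= mulr1; congr (_ + _).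
by apply: eq_bigr => i _; rewrite liftK.
Qed.

End EvenForms.

Theorem proposition3p10 (R : realType) (n s : nat)
    (g : 'I_s -> {mpoly R[n.+1]}) (f : {mpoly R[n.+1]})
    (hg : forall i, even_form (g i))
    (hf : even_form f)
    (f_pos : positive_on f (proj_semialg g)) :
  exists N : nat,
    homog_quad_module g ((\sum_(i < n.+1) 'X_i ^+ 2) ^+ N * f).
Proof.
have f_gt0 := positive_on_vectors hg hf f_pos.
have [df {}hf] := even_form_half hf.
have /fin_all_exists[dg {}hg] i := even_form_half (hg i).
have [F hF FE] := subst_surj hf.
have /fin_all_exists2[G hG GE] i := subst_surj (hg i).
(* The constraints on the simplex are the lifts [G] of [g] and, for each
   relation [r = 0], the inequality [- r ^+ 2 >= 0]. *)
pose J := (form_index n.+1 + 'I_n.+1 * 'I_n.+1 * 'I_n.+1)%type.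
pose rel (j : J) := match j with inl t => lin_rel R t | inr t => quad_rel R t end.
pose drel (j : J) := if j is inl _ then 1%N else 2%N.
have rel_homog j : rel j \is (drel j).-homog.
  by case: j => t; [exact: lin_rel_homog|exact: quad_rel_homog].
have subst_rel j : rel j \mPo sq_forms R n.+1 = 0.
  by case: j => t; [exact: subst_lin_rel|exact: subst_quad_rel].
pose h (i : 'I_s + J) := match i with inl i => G i | inr j => - rel j ^+ 2 end.
pose dh (i : 'I_s + J) := match i with inl i => dg i | inr j => (drel j * 2)%N end.
have hh i : h i \is (dh i).-homog.
  by case: i => [i|j] /=; rewrite ?rpredN ?dhomogMn.
have F_pos v : in_simplex v -> (forall i, 0 <= (h i).@[v]) -> 0 < F.@[v].
  move=> v_in h_ge0.
  have rel0 j : (rel j).@[v] = 0.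
    have := h_ge0 (inr j); rewrite mevalN rmorphXn /= oppr_ge0 => rel_le0.
    by apply/eqP; rewrite -sqrf_eq0 eq_le rel_le0 sqr_ge0.
  have [x [x0 xv]] := square_image v_in (fun t => rel0 (inl t)) (fun t => rel0 (inr t)).
  rewrite -(meval_subst F xv) FE; apply: f_gt0 => // i.
  by rewrite /eval_at -GE (meval_subst _ xv); exact: h_ge0 (inl i).
have [N [D [b [e [u [hu bE ND rest_ge0]]]]]] := simplex_certificate hh hF F_pos.
exists N.
rewrite -/(sqnorm R n.+1); set q := sqnorm R n.+1.
set H := (_ - _) in rest_ge0.
have hH : H \is D.-homog.
  have hs k : var_sum R #|{: form_index n.+1}| ^+ k \is k.-homog.
    by rewrite -{2}[k]mul1n dhomogMn // var_sum_homog.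
  rewrite rpredB //; first by rewrite -ND dhomogM.
  by apply: rpred_sum => i _; rewrite -(bE i) !dhomogM ?dhomogMn.
pose c : R := (4 * n.+1)%:R; have c_gt0 : 0 < c by rewrite ltr0n.
pose w i := u i \mPo sq_forms R n.+1.
(* The certificate after substitution: the relations map to zero, so only
   the terms of the original constraints survive. *)
have key : (c *: q) ^+ N * f =
    (H \mPo sq_forms R n.+1) + \sum_i (c *: q) ^+ b (inl i) * w (inl i) ^+ 2 * g i.
  have substs k : var_sum R #|{: form_index n.+1}| ^+ k \mPo sq_forms R n.+1
                  = (c *: q) ^+ k.
    by rewrite rmorphXn /= subst_var_sum.
  have subst_sum (I : finType) (E : I -> {mpoly R[#|{: form_index n.+1}|]}) :
      (\sum_i E i) \mPo sq_forms R n.+1 = \sum_i (E i \mPo sq_forms R n.+1).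
    exact: raddf_sum.
  rewrite /H comp_mpolyB rmorphM /= substs FE subst_sum big_sumType /=.
  rewrite [X in _ - (_ + X)]big1 ?addr0.
    rewrite -[LHS](addrNK (\sum_i (c *: q) ^+ b (inl i) * w (inl i) ^+ 2 * g i)).
    congr (_ - _ + _); apply: eq_bigr => i _.
    by rewrite !rmorphM /= substs GE.
  move=> j _.
  by rewrite rmorphM /= rmorphN rmorphXn /= subst_rel expr0n /= oppr0 mulr0.
have cN_ge0 : 0 <= (c ^+ N)^-1 by rewrite invr_ge0 exprn_ge0 // ltW.
have cN0 : c ^+ N != 0 by rewrite expf_neq0 // gt_eqF.
apply: (@homog_quad_module_intro _ _ _ _ (D * 2) _
   ((c ^+ N)^-1 *: (H \mPo sq_forms R n.+1))
   (fun i => (c ^+ N)^-1 *: ((c *: q) ^+ b (inl i) * w (inl i) ^+ 2))).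
- by exists D; apply: sosZ => //; exact: subst_sos.
- by rewrite dhomogZ // subst_homog.
- move=> i; eexists; apply: sosZ => //; apply: sosM.
    by apply/sosX/sosZ/sos_sqnorm/ltW.
  by apply/sos_sqr/subst_homog/hu.
- move=> i; rewrite -scalerAl dhomogZ // -(bE (inl i)) !mulnDl.
  rewrite !dhomogM //; first by rewrite mulnC dhomogMn // dhomogZ // sqnorm_homog.
  by rewrite dhomogMn // subst_homog.
have -> : q ^+ N * f = (c ^+ N)^-1 *: ((c *: q) ^+ N * f).
  by rewrite exprZn -scalerAl scalerA mulVf // scale1r.
rewrite key scalerDr; congr (_ + _); rewrite [LHS]scaler_sumr.
by apply: eq_bigr => i _; rewrite scalerAl.
Qed.
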